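(* Let $T$ be a Souslin tree, equipped with the interval topology. Then $T$ is not a $\Delta$-space.
   Context: A tree is a well-founded partially ordered set in which the set of predecessors of any element is well-ordered. An $\omega_1$-tree is a tree of height $\omega_1$ all of whose levels are countable. A Souslin tree is an $\omega_1$-tree such that every branch and every antichain is at most countable. The interval topology on a tree $T$ is generated by the open base consisting of all intervals $(s,t]=\{x\in T: s<x\le t\}$ together with all singletons $\{t\}$ where $t$ is a minimal element of $T$. A topological space $X$ is a $\Delta$-space if for every decreasing sequence $\{D_n:n\in\omega\}$ of subsets of $X$ with empty intersection there is a decreasing sequence $\{V_n:n\in\omega\}$ of open subsets of $X$, also with empty intersection, such that $D_n\subseteq V_n$ for every $n\in\omega$. *)

(* Defs.v *)
From HB Require Import structures.
From mathcomp Require Import all_boot all_order.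
From mathcomp Require Import all_classical wochoice topology.

Set Implicit Arguments.
Unset Strict Implicit.
Unset Printing Implicit Defensive.

Import Order.TTheory.

Local Open Scope order_scope.
Local Open Scope classical_set_scope.

HB.mixin Record isTree d T & Order.POrder d T := {
  tree_wf : well_founded (fun x y : T => x < y);
  tree_wo : forall t : T, wo_chain (<=%O : rel T) [pred s : T | s < t]
}.

#[short(type="treeType")]
HB.structure Definition Tree d := {T of Order.POrder d T & isTree d T}.

(* There is no type of ordinals in the library: an ordinal is represented by  *)
(* a well-ordered type W, whose elements a stand for the smaller ordinals,    *)
(* namely the order types of the initial segments [set b | b < a].            *)
Definition is_omega1 d (W : orderType d) : Prop :=
  [/\ well_order (<=%O : rel W),
      ~ countable [set: W] &
      forall a : W, countable [set b : W | b < a]].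

Section trees.
Context {d : Order.disp_t} (T : treeType d).

(* level T a consists of the t whose set of predecessors has order type a *)
Definition level d' (W : orderType d') (a : W) : set T :=
  [set t | exists2 f : T -> W,
    set_bij [set s | s < t] [set b | b < a] f &
    forall r s, r < t -> s < t -> (f r <= f s) = (r <= s)].

Definition has_height d' (W : orderType d') : Prop :=
  (forall a : W, level a !=set0) /\ \bigcup_(a : W) level a = [set: T].

Definition omega1_tree : Prop :=
  exists (d' : Order.disp_t) (W : orderType d'),
    [/\ is_omega1 W, has_height W & forall a : W, countable (level a)].

Definition antichain (A : set T) : Prop :=
  forall x y, A x -> A y -> x <> y -> x >< y.

Definition branch (B : set T) : Prop :=
  total_on B (<=%O : rel T) /\
  forall C, total_on C (<=%O : rel T) -> B `<=` C -> C = B.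

Definition souslin_tree : Prop :=
  [/\ omega1_tree,
      forall B, branch B -> countable B &
      forall A, antichain A -> countable A].

Definition interval_base : set (set T) :=
  [set [set x | s < x <= t] | s in [set: T] & t in [set: T]] `|`
  [set [set t] | t in minimal (<=%O : rel T)].

Let interval_base_cover : \bigcup_(U in interval_base) id U = [set: T].
Proof.
apply/seteqP; split => // t _.
have [tmin|] := pselect (minimal (<=%O : rel T) t).
  by exists [set t] => //; right; exists t.
move=> /existsNP[s /not_implyP[st /negP ts]].
exists [set x | s < x <= t]; first by left; exists s => //; exists t.
by rewrite /= lexx andbT lt_leAnge st.
Qed.

Lemma tree_lt_total (t r s : T) : r < t -> s < t -> (r <= s) || (s <= r).
Proof.
move=> rt st.
have [||z [[+ zmin] _]] := @tree_wo d T t [pred x | (x == r) || (x == s)].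
- by move=> x /orP[]/eqP ->.
- by exists r; rewrite inE eqxx.
- have := zmin r; have := zmin s.
  rewrite !inE !eqxx orbT => /(_ isT) zs /(_ isT) zr.
  by move=> /orP[]/eqP zE; rewrite -zE ?zs// zr orbT.
Qed.

Let interval_base_join (U V : set T) (t : T) :
  interval_base U -> interval_base V -> id U t -> id V t ->
  exists W, [/\ interval_base W, id W t & id W `<=` id U `&` id V].
Proof.
move=> bU bV; case: (bU) => [[s _ [u _ <-]]|[u umin <-]]; last first.
  by move=> /= -> Vu; exists [set u]; split => //; [right; exists u|move=> _ ->].
case: (bV) => [[s' _ [u' _ <-]]|[u' umin <-]]; last first.
  by move=> Uu /= tu'; subst u'; exists [set t]; split => //; [right; exists t|move=> _ ->].
move=> /= /andP[st tu] /andP[s't tu'].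
have /orP[ss'|s's] := tree_lt_total st s't.
- exists [set x | s' < x <= t]; split; first by left; exists s' => //; exists t.
    by rewrite /= s't lexx.
  move=> x /= /andP[s'x xt].
  by rewrite s'x (le_lt_trans ss' s'x) !(le_trans xt).
- exists [set x | s < x <= t]; split; first by left; exists s => //; exists t.
    by rewrite /= st lexx.
  move=> x /= /andP[sx xt].
  by rewrite sx (le_lt_trans s's sx) !(le_trans xt).
Qed.

Definition interval_topology : Type := T.

HB.instance Definition _ := Choice.on interval_topology.
HB.instance Definition _ := isBaseTopological.Build interval_topology
  interval_base_cover interval_base_join.

Lemma basis_interval_base : @basis interval_topology interval_base.
Proof.
split=> [U bU|t A].
  by exists [set U]; [move=> _ ->|rewrite bigcup_set1].
rewrite nbhsE => -[U [[D Db <-] [B DB Bt]] UA].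
exists B; first by split; [exact: Db|].
by move=> x Bx; apply: UA; exists B.
Qed.

End trees.

Definition Delta_space (X : topologicalType) : Prop :=
  forall D : nat -> set X,
    (forall m n, (m <= n)%N -> D n `<=` D m) -> \bigcap_n D n = set0 ->
  exists V : nat -> set X,
    [/\ forall m n, (m <= n)%N -> V n `<=` V m,
        forall n, open (V n),
        \bigcap_n V n = set0 &
        forall n, D n `<=` V n].

(* Main.v *)
Require Import Defs.
From mathcomp Require Import all_boot all_order all_classical topology.


(** Let ht : T -> omega_1 be the height function. In a Souslin tree every set
P of nodes is reflected below some countable height b: the minimal elements of
P form an antichain, so their heights are bounded by some b, and every element
of P lies above one of them (souslin_reflect).

Let F be a closed set. Reflecting, for each ordinal b, the part of F of height
above b gives an ordinal h b. If a > 0 is closed under h, take a node x of F of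
height at least a and the node y of height a below or equal to x. Whenever
s < y, the set F has an element c <= x with ht s < ht c < a. Both c and y lie
below x, so they are comparable and s < c < y. Hence y is a limit of points of
F, so y is in F (open_level_reflect, stated for the complement of F). Thus a
closed set of unbounded height meets every level whose index belongs to some
closed unbounded subset of omega_1, and an open set containing all levels
indexed by a stationary set contains all nodes above some height
(open_stationary_bounded).

By Ulam's theorem (ulam), omega_1 contains pairwise disjoint stationary sets
S 0, S 1, and so on. Let D n be the set of nodes whose height lies in S m for
some m >= n: this sequence decreases and has empty intersection. If open sets
V n contain D n, then each V n contains all nodes above some height a n. The
countably many ordinals a n have a common upper bound, and any node of that
height lies in every V n. So T is not a Delta-space. *)

Import Order.TTheory.

Local Open Scope order_scope.
Local Open Scope classical_set_scope.

(** * Stationary sets in the first uncountable ordinal *)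

Section omega1.
Context {d : Order.disp_t} {W : orderType d} (W_omega1 : is_omega1 W).

Lemma omega1_least (P : set W) : P !=set0 ->
  exists2 m, P m & forall y, P y -> m <= y.
Proof.
case: W_omega1 => wo _ _ [x Px].
have [|m [[mP minm] _]] := wo (fun y => `[< P y >]).
  by exists x; rewrite unfold_in; apply/asboolP.
exists m; first by apply/asboolP; rewrite unfold_in in mP.
by move=> y Py; apply: minm; rewrite unfold_in; apply/asboolP.
Qed.

Lemma omega1_countable_le (a : W) : countable [set b | b <= a].
Proof.
have -> : [set b | b <= a] = [set b | b < a] `|` [set a].
  apply/seteqP; split => b /=; rewrite le_eqVlt.
    by move=> /orP[/eqP ->|]; [right|left].
  by move=> [->|->]; rewrite ?eqxx ?orbT.
by rewrite -bigcup2E; apply: bigcup_countable => // -[|[|n]] _ /=;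
  [case: W_omega1 => _ _; exact|exact: countable1|exact: countable0].
Qed.

Lemma omega1_bounded (A : set W) : countable A ->
  exists b, forall a, A a -> a < b.
Proof.
move=> Ac; apply: contrapT => nob; case: (W_omega1) => _ + _; apply.
have -> : [set: W] = \bigcup_(a in A) [set b | b <= a].
  apply/seteqP; split => // b _; apply: contrapT => bA; apply: nob.
  exists b => a Aa; rewrite ltNge; apply/negP => ba; apply: bA.
  by exists a.
by apply: bigcup_countable => // a _; exact: omega1_countable_le.
Qed.

Lemma omega1_bounded_image (A : set W) (f : W -> W) : countable A ->
  exists b, forall a, A a -> f a < b.
Proof.
move=> Ac; have [b bP] : exists b, forall a, (f @` A) a -> a < b.
  by apply: omega1_bounded; apply: sub_countable Ac; exact: card_image_le.
by exists b => a Aa; apply: bP; exists a.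
Qed.

Lemma omega1_bounded_seq (f : nat -> W) : exists b, forall n, f n < b.
Proof.
have [b bP] : exists b, forall a, range f a -> a < b.
  by apply: omega1_bounded; apply: sub_countable (card_image_le _ _) _.
by exists b => n; apply: bP; exists n.
Qed.

(** The ordinals closing for h form a closed unbounded set, and every closed
unbounded set contains one of this form (let h b be an element of it above b).
Coding these sets by functions makes the diagonal bound over countably many of
them pointwise. The value 0, vacuously closed under h, is excluded. *)
Definition closing (h : W -> W) (a : W) : Prop :=
  (exists b, b < a) /\ forall b, b < a -> h b < a.

Definition stationary (S : set W) : Prop :=
  forall h : W -> W, exists2 a, S a & closing h a.

(** A closing ordinal is the supremum of an omega-sequence in which each term
bounds the values of h up to the preceding term. *)
Lemma closing_exists (h : W -> W) : exists a, closing h a.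
Proof.
have /choice[g gP] : forall a, exists c, forall b, b <= a -> h b < c.
  by move=> a; apply: omega1_bounded_image; exact: omega1_countable_le.
have [a0 _] : [set: W] !=set0.
  apply/set0P/eqP => W0; case: W_omega1 => _ + _; apply.
  by rewrite W0; exact: countable0.
pose s n := iter n g a0.
have [b sb] := omega1_bounded_seq s.
have [|a sa mina] := @omega1_least [set a | forall n, s n < a].
  by exists b.
exists a; split; first by exists a0; exact: (sa 0%N).
move=> c ca; have [n cn] : exists n, c <= s n.
  apply: contrapT => noc; suff : a <= c by rewrite leNgt ca.
  by apply: mina => n; rewrite ltNge; apply/negP => ?; apply: noc; exists n.
exact: lt_trans (gP (s n) c cn) (sa n.+1).
Qed.

Lemma stationary_tail (b : W) : stationary [set a | b < a].
Proof.
move=> h; have [a [[c ca] clos]] := closing_exists (fun c => Order.max b (h c)).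
exists a; first by have := clos c ca; rewrite gt_max => /andP[].
split; first by exists c.
by move=> e /clos; rewrite gt_max => /andP[].
Qed.

(** Countable completeness of the nonstationary ideal: a closing point of
a function lying above countably many others is a closing point of each. *)
Lemma stationary_bigcup (S : nat -> set W) :
  stationary (\bigcup_n S n) -> exists n, stationary (S n).
Proof.
move=> statS; apply: contrapT => noS.
have /choice[h hP] : forall n, exists h, forall a, S n a -> ~ closing h a.
  move=> n; apply: contrapT => noh; apply: noS; exists n => h.
  apply: contrapT => noa; apply: noh; exists h => a Sa cla.
  by apply: noa; exists a.
have /choice[g gP] : forall b, exists c, forall n, h n b < c.
  by move=> b; exact: omega1_bounded_seq.
have [a [n _ Sna] [a0 cla]] := statS g.
apply: (hP n a Sna); split => // b ba.
exact: lt_trans (gP b n) (cla b ba).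
Qed.

(** Ulam's matrix: fix injections e a of the ordinals below a into nat and let
U b n be the set of a > b with e a b = n. Each row b covers a tail of omega_1,
so it has a stationary entry, in some column k b. By the pigeonhole principle
one column n is chosen by infinitely many rows, and the entries of a single
column are disjoint because e a is injective. *)
Lemma ulam : exists S : nat -> set W,
  (forall n, stationary (S n)) /\ trivIset [set: nat] S.
Proof.
have /choice[e eP] : forall a : W, exists f : W -> nat,
    {in [set b | b < a] &, injective f}.
  by move=> a; apply/countable_injP; case: W_omega1 => _ _; exact.
pose U b n := [set a | b < a /\ e a b = n].
have /choice[k kP] : forall b, exists n, stationary (U b n).
  move=> b; apply: stationary_bigcup; have -> // : \bigcup_n U b n = [set a | b < a].
    by apply/seteqP; split => [a [n _ []]|a ba] //; exists (e a b).
  exact: stationary_tail.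
have [n nP] : exists n, infinite_set [set b | k b = n].
  apply: contrapT => fin; case: (W_omega1) => _ + _; apply.
  have -> : [set: W] = \bigcup_n [set b | k b = n].
    by apply/seteqP; split => // b _; exists (k b).
  apply: bigcup_countable => // n _; apply: finite_set_countable.
  by apply: contrapT => ?; apply: fin; exists n.
have [u uk uinj] : exists2 u : nat -> W, (forall m, k (u m) = n) & injective u.
  have /infiniteP/card_leP[f] := nP.
  exists (fun m => val (f (to_setT m))) => [m|i j].
    exact: (set_valP (f (to_setT m))).
  by move=> /val_inj/inj; rewrite !in_setT => /(_ isT isT)/(congr1 val).
exists (fun m => U (u m) n); split; first by move=> m; rewrite -(uk m).
move=> i j _ _ [a [[uia ei] [uja ej]]]; apply: uinj.
by apply: (eP a); rewrite ?inE // ei ej.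
Qed.

End omega1.

(** * The height function *)

Section height.
Context {d d' : Order.disp_t} {T : treeType d} {W : orderType d'}.

(** The isomorphisms that witness membership in a level, kept explicit because
their values are the heights of the predecessors. *)
Definition level_map (a : W) (t : T) (f : T -> W) : Prop :=
  set_bij [set s | s < t] [set b | b < a] f /\
  forall r s, r < t -> s < t -> (f r <= f s) = (r <= s).

(** Rigidity of well-orders: if s is a first point of disagreement, the smaller
of the two values is omitted by the map taking the larger one. *)
Lemma level_map_unique a b t f g : level_map a t f -> level_map b t g ->
  forall s, s < t -> f s = g s.
Proof.
suff step a1 b1 f1 g1 s : level_map a1 t f1 -> level_map b1 t g1 -> s < t ->
    (forall r, r < s -> f1 r = g1 r) -> ~~ (f1 s < g1 s).
  move=> fa gb s; elim/(well_founded_ind (@tree_wf d T)): s => s IH st.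
  have {}IH r : r < s -> f r = g r by move=> rs; apply: IH => //; exact: lt_trans st.
  apply/eqP; rewrite eq_le !leNgt (step _ _ _ _ _ gb fa) ?(step _ _ _ _ _ fa gb) //.
  by move=> r rs; rewrite IH.
move=> [[fim finj fsurj] fle] [[gim ginj gsurj] gle] st IH.
apply/negP => fg; have [|r rt gr] := gsurj (f1 s).
  by apply: lt_trans fg _; exact: gim.
have rs : r < s by rewrite lt_leAnge -!gle // gr -lt_leAnge.
have : r = s by apply: finj; rewrite ?inE // IH.
by move=> rsE; rewrite rsE ltxx in rs.
Qed.

Lemma level_map_height_le a b t f g : level_map a t f -> level_map b t g ->
  a <= b.
Proof.
move=> fa gb; rewrite leNgt; apply/negP => ba.
have [[fim _ fsurj] _] := fa; have [|s st fs] := fsurj b; first exact: ba.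
have [[gim _ _] _] := gb; have := gim s st.
by rewrite /= -(level_map_unique _ _ _ _ _ fa gb) // fs ltxx.
Qed.

Lemma level_map_restrict a t f s : level_map a t f -> s < t ->
  level_map (f s) s f.
Proof.
move=> [[fim finj fsurj] fle] st.
have ltE r r' : r < t -> r' < t -> (f r < f r') = (r < r').
  by move=> rt r't; rewrite !lt_leAnge !fle.
split.
  split => [r rs|r r'|b /= bs].
  - by rewrite /= ltE // (lt_trans rs).
  - by rewrite !inE => rs r's; apply: finj; rewrite inE; [exact: lt_trans st|exact: lt_trans st].
  - have [|r rt rb] := fsurj b; first by apply: lt_trans bs _; exact: fim.
    by exists r => //; rewrite /= -ltE // rb.
by move=> r r' rs r's; apply: fle; [exact: lt_trans st|exact: lt_trans st].
Qed.

Lemma height_function : has_height T W -> exists ht : T -> W,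
  [/\ forall a, exists t, ht t = a,
      {homo ht : s t / s < t} &
      forall t b, b < ht t -> exists2 s, s < t & ht s = b].
Proof.
move=> [lev0 levT].
have /choice[ht htP] : forall t, exists a, exists f, level_map a t f.
  move=> t; have : [set: T] t by []. rewrite -levT => -[a _ [f fb fle]].
  by exists a, f.
have htE a t f : level_map a t f -> ht t = a.
  move=> fa; have [g ga] := htP t.
  by apply/eqP; rewrite eq_le (level_map_height_le _ _ _ _ _ fa ga)
    (level_map_height_le _ _ _ _ _ ga fa).
exists ht; split.
- by move=> a; have [t [f fb fle]] := lev0 a; exists t; apply: (htE _ _ f).
- move=> s t st; have [f fa] := htP t.
  rewrite (htE _ _ _ (level_map_restrict _ _ _ _ fa st)).
  by case: fa => -[fim _ _] _; exact: fim.
- move=> t b bt; have [f fa] := htP t.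
  have [[_ _ fsurj] _] := fa; have [s st fs] := fsurj b bt.
  by exists s => //; rewrite (htE _ _ _ (level_map_restrict _ _ _ _ fa st)).
Qed.

End height.

(** * Order and interval topology of a tree *)

Lemma wf_minimal_elt {T : Type} (R : T -> T -> Prop) (P : set T) (x : T) :
  well_founded R -> P x -> exists2 m, P m & forall y, R y m -> ~ P y.
Proof.
move=> wfR; elim/(well_founded_ind wfR): x => x IH Px.
have [[y Ryx Py]|noy] := pselect (exists2 y, R y x & P y); first exact: IH Py.
by exists x => // y Ryx Py; apply: noy; exists y.
Qed.

Lemma tree_le_total {d} {T : treeType d} (t r s : T) :
  r <= t -> s <= t -> (r <= s) || (s <= r).
Proof.
rewrite le_eqVlt => /orP[/eqP->|rt]; first by move=> ->; rewrite orbT.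
rewrite le_eqVlt => /orP[/eqP->|st]; first by rewrite ltW.
exact: tree_lt_total rt st.
Qed.

(** A non-minimal point is in no singleton of the base, so its basic
neighbourhoods are all intervals. *)
Lemma open_interval_left {d} {T : treeType d} (V : set (interval_topology T))
    (r t : T) : open V -> V t -> r < t ->
  exists2 s, s < t & forall x, s < x -> x <= t -> V x.
Proof.
move=> oV Vt rt; have [_ base] := basis_interval_base T.
have [B [bB Bt] BV] : filter_from
    [set U | interval_base U /\ U t] id V.
  by apply: base; exact: open_nbhs_nbhs.
case: bB => [[s _ [u _ BE]]|[u umin BE]]; subst B; rewrite /= in Bt.
  case/andP: Bt => st tu; exists s => // x sx xt.
  by apply: BV; rewrite /= sx (le_trans xt).
have tr : t <= r by rewrite [t]Bt; apply: umin; rewrite -[u]Bt; exact: ltW.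
by have := lt_le_trans rt tr; rewrite ltxx.
Qed.

(** * Reflection in Souslin trees *)

Section souslin.
Context {d d' : Order.disp_t} {T : treeType d} {W : orderType d'}.
Hypothesis W_omega1 : is_omega1 W.
Hypothesis T_ccc : forall A : set T, antichain A -> countable A.
Variable ht : T -> W.
Hypothesis ht_homo : {homo ht : s t / s < t}.
Hypothesis ht_surj : forall t b, b < ht t -> exists2 s, s < t & ht s = b.

(** The minimal elements of P form an antichain, hence a countable set, and by
well-foundedness one of them lies below each element of P. *)
Lemma souslin_reflect (P : set T) :
  exists b, forall x, P x -> exists a, [/\ P a, a <= x & ht a < b].
Proof.
pose A := [set a | P a /\ forall y, y < a -> ~ P y].
have Aanti : antichain A.
  move=> x y [Px minx] [Py miny] xy; apply/negP => /orP[]; rewrite le_eqVlt.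
  - by move=> /orP[/eqP //|/miny]; exact.
  - by move=> /orP[/eqP //|/minx]; [move=> yx; apply: xy|exact].
have [b bP] : exists b, forall c, (ht @` A) c -> c < b.
  apply: omega1_bounded => //; apply: sub_countable (T_ccc A Aanti).
  exact: card_image_le.
exists b => x Px.
have [a [Pa ax] mina] := wf_minimal_elt (fun y z : T => y < z)
  [set y | P y /\ y <= x] x (@tree_wf d T) (conj Px (lexx x)).
exists a; split => //; apply: bP; exists a => //; split => // y ya Py.
by apply: (mina y ya); split => //; exact: le_trans (ltW ya) ax.
Qed.

(** With F the complement of V, h b reflects the part of F of height above b.
If a is closing for h and x in F has height at least a, the node of height a
below or equal to x is a limit of elements of F, as the reflected elements can
be taken below x. *)
Lemma open_level_reflect (V : set (interval_topology T)) : open V ->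
  exists h : W -> W, forall a, closing h a ->
    forall x, ~ V x -> a <= ht x -> exists2 y, ~ V y & ht y = a.
Proof.
move=> oV.
have /choice[h hP] : forall b, exists e, forall x, ~ V x -> b < ht x ->
    exists c : T, [/\ ~ V c, b < ht c, c <= x & ht c < e].
  move=> b; have [e eP] := souslin_reflect [set x | ~ V x /\ b < ht x].
  exists e => x Vx bx; have [c [[Vc bc] cx ce]] := eP x (conj Vx bx).
  by exists c.
exists h => a [[b ba] cla] x Vx ax.
have [y yx hy] : exists2 y, y <= x & ht y = a.
  move: ax; rewrite le_eqVlt => /orP[/eqP ->|ax]; first by exists x.
  by have [y yx hy] := ht_surj x a ax; exists y => //; exact: ltW.
exists y => // Vy.
(* V contains an interval ]s, y]; the point of the complement of V reflected
   from x above the height of s falls into it. *)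
have [r ry _] : exists2 r, r < y & ht r = b by apply: ht_surj; rewrite hy.
have [s sy sV] := open_interval_left V r y oV Vy ry.
have sa : ht s < a by rewrite -hy; exact: ht_homo.
have [c [Vc sc cx ch]] := hP (ht s) x Vx (lt_le_trans sa ax).
have ca : ht c < a by apply: lt_trans ch _; exact: cla.
have cy : c < y.
  have /orP[|yc] := tree_le_total x c y cx yx.
    rewrite le_eqVlt => /orP[/eqP cy|//].
    by move: ca; rewrite cy hy ltxx.
  move: yc ca; rewrite le_eqVlt -hy => /orP[/eqP->|/ht_homo yc /(lt_trans yc)];
  by rewrite ltxx.
apply: Vc; apply: sV; last exact: ltW.
have /orP[] := tree_le_total y s c (ltW sy) (ltW cy).
  by rewrite le_eqVlt => /orP[/eqP sE|//]; rewrite sE ltxx in sc.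
rewrite le_eqVlt => /orP[/eqP sE|/ht_homo cs]; first by rewrite sE ltxx in sc.
by have := lt_trans sc cs; rewrite ltxx.
Qed.

Lemma open_stationary_bounded (V : set (interval_topology T)) (S : set W) :
  open V -> stationary S -> ht @^-1` S `<=` V ->
  exists a, forall x, ~ V x -> ht x < a.
Proof.
move=> oV statS SV; have [h hP] := open_level_reflect V oV.
have [a Sa cla] := statS h; exists a => x Vx.
rewrite ltNge; apply/negP => ax; have [y Vy hy] := hP a cla x Vx ax.
by apply: Vy; apply: SV; rewrite /= hy.
Qed.

End souslin.

(** * Souslin trees and the Delta property *)

Theorem theorem3p6 (d : Order.disp_t) (T : treeType d) (hT : souslin_tree T) :
  ~ Delta_space (interval_topology T).
Proof.
case: hT => -[d' [W [W1 Wht _]]] _ ccc Delta.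
have [ht [htonto hthomo htsurj]] := height_function Wht.
have [S [Sstat Sdisj]] := ulam W1.
pose D n : set (interval_topology T) := ht @^-1` (\bigcup_(m in [set m | (n <= m)%N]) S m).
have Ddecr m n : (m <= n)%N -> D n `<=` D m.
  by move=> mn x [k nk Sk]; exists k => //; exact: leq_trans nk.
have D0 : \bigcap_n D n = set0.
  apply/seteqP; split => // x Dx; have [m _ Sm] := Dx 0%N I.
  have [k mk Sk] := Dx m.+1 I.
  have mkE : m = k by apply: Sdisj => //; exists (ht x).
  by rewrite /= mkE ltnn in mk.
have [V [Vdecr Vopen V0 DV]] := Delta D Ddecr D0.
have /choice[a aP] : forall n, exists a, forall x, ~ V n x -> ht x < a.
  move=> n; apply: (open_stationary_bounded W1 ccc ht hthomo htsurj (V n) (S n)) => //.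
  by apply: subset_trans (DV n) => x Sx; exists n => /=.
have [b ab] := omega1_bounded_seq W1 a.
have [t htt] := htonto b.
have : (\bigcap_n V n) t.
  move=> n _; apply: contrapT => Vt; have := aP n t Vt.
  by rewrite htt => /lt_trans /(_ (ab n)); rewrite ltxx.
by rewrite V0.
Qed.
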